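(* Let $u_\theta:\mathbb{R}^{d_0}\to\mathbb{R}^{d_L}$ be an $L$-layer fully connected neural network with weights $\mathbf{W}^{(k)}$, biases $\mathbf{b}^{(k)}$, activation $\sigma$, pre-activations $y^{(k)}$ and post-activations $z^{(k)}$, let $\mathcal{C}\subseteq\mathbb{R}^{d_0}$ be the input domain, and let $i\in\{1,\dots,d_0\}$. Assume that for every $k$ we are given affine bounds $\mathbf{A}^{(k),L}\mathbf{x}+\mathbf{a}^{(k),L}\le y^{(k)}(\mathbf{x})\le \mathbf{A}^{(k),U}\mathbf{x}+\mathbf{a}^{(k),U}$ and constant bounds $y^{(k),L}\le y^{(k)}(\mathbf{x})\le y^{(k),U}$, valid componentwise for all $\mathbf{x}\in\mathcal{C}$. Assume moreover that (through a previous computation of bounds on $\partial_{\mathbf{x}_i}u_\theta$) for every $k\in\{1,\dots,L-1\}$ we are given affine bounds $$\mathbf{C}^{(k),L}\mathbf{x}+\mathbf{c}^{(k),L}\le\partial_{\mathbf{x}_i}z^{(k-1)}(\mathbf{x})\le\mathbf{C}^{(k),U}\mathbf{x}+\mathbf{c}^{(k),U},$$ $$\mathbf{D}^{(k),L}\mathbf{x}+\mathbf{d}^{(k),L}\le\partial_{z^{(k-1)}}z^{(k)}(\mathbf{x})\le\mathbf{D}^{(k),U}\mathbf{x}+\mathbf{d}^{(k),U},$$ valid entrywise for all $\mathbf{x}\in\mathcal{C}$. Then for every $j\in\{1,\dots,d_L\}$ there exist two functions $\partial_{\mathbf{x}_i^2}u^{U}_{\theta,j}$ and $\partial_{\mathbf{x}_i^2}u^{L}_{\theta,j}$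 of $\mathbf{x}$ such that for all $\mathbf{x}\in\mathcal{C}$ $$\partial_{\mathbf{x}_i^2}u^{L}_{\theta,j}(\mathbf{x})\le\partial_{\mathbf{x}_i^2}u_{\theta,j}(\mathbf{x})\le\partial_{\mathbf{x}_i^2}u^{U}_{\theta,j}(\mathbf{x}),$$ and which can be written as $$\partial_{\mathbf{x}_i^2}u^{U}_{\theta,j}(\mathbf{x})=\psi^{(1),U}_{0,j,i}+\sum_{r=1}^{d_0}\left(\psi^{(1),U}_{1,j,r}\,\mathbf{x}+\psi^{(1),U}_{2,j,r}\right),\qquad \partial_{\mathbf{x}_i^2}u^{L}_{\theta,j}(\mathbf{x})=\psi^{(1),L}_{0,j,i}+\sum_{r=1}^{d_0}\left(\psi^{(1),L}_{1,j,r}\,\mathbf{x}+\psi^{(1),L}_{2,j,r}\right),$$ where, for $p\in\{0,1,2\}$, the coefficients $\psi^{(1),U}_{p,j,r}$ and $\psi^{(1),L}_{p,j,r}$ (real numbers for $p\in\{0,2\}$, row vectors in $\mathbb{R}^{1\times d_0}$ for $p=1$) are functions of the quantities $\mathbf{W}^{(k)}$, $y^{(k),L}$, $y^{(k),U}$, $\mathbf{A}^{(k),L}$, $\mathbf{A}^{(k),U}$, $\mathbf{a}^{(k),L}$, $\mathbf{a}^{(k),U}$, $\mathbf{C}^{(k),L}$, $\mathbf{C}^{(k),U}$, $\mathbf{c}^{(k),L}$, $\mathbf{c}^{(k),U}$, $\mathbf{D}^{(k),L}$, $\mathbf{D}^{(k),U}$, $\mathbf{d}^{(k),L}$, $\mathbf{d}^{(k),U}$,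 and can be computed using a recursive (over the layers) closed-form expression in $\mathcal{O}(L)$ time.
   Context: Network. $u_\theta(\mathbf{x})=y^{(L)}(\mathbf{x})$, where $z^{(0)}(\mathbf{x})=\mathbf{x}$, $y^{(k)}(\mathbf{x})=\mathbf{W}^{(k)}z^{(k-1)}(\mathbf{x})+\mathbf{b}^{(k)}$ for $k\in\{1,\dots,L\}$, and $z^{(k)}(\mathbf{x})=\sigma(y^{(k)}(\mathbf{x}))$ for $k\in\{1,\dots,L-1\}$, with $\mathbf{W}^{(k)}\in\mathbb{R}^{d_k\times d_{k-1}}$, $\mathbf{b}^{(k)}\in\mathbb{R}^{d_k}$. The activation $\sigma:\mathbb{R}\to\mathbb{R}$ is twice differentiable and applied componentwise. $u_{\theta,j}$ is the $j$-th output; $\partial_{\mathbf{x}_i}$ and $\partial_{\mathbf{x}_i^2}$ are the first and second partial derivatives with respect to the $i$-th input component. $\partial_{z^{(k-1)}}z^{(k)}=\mathrm{diag}[\sigma'(y^{(k)})]\mathbf{W}^{(k)}\in\mathbb{R}^{d_k\times d_{k-1}}$ is the Jacobian of layer $k$ with respect to the output of layer $k-1$, regarded as a function of $\mathbf{x}$; its affine bounds mean that for each entry $(j,n)$ there is a row vector $\mathbf{D}^{(k),\cdot}_{j,n}\in\mathbb{R}^{1\times d_0}$ and a real $\mathbf{d}^{(k),\cdot}_{j,n}$. All inequalities are entrywise. Relaxations. It is assumed that, for any real $l\le u$, one can compute in $\mathcal{O}(1)$ time from $l,u$ the coefficients of affine functions bounding $\sigma'$ from below and above on $[l,u]$, and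 likewise affine functions bounding $\sigma''$ from below and above on $[l,u]$; these are applied with $[l,u]=[y^{(k),L}_j,y^{(k),U}_j]$. Time is counted as a function of the number of layers $L$, with the layer widths $d_k$ regarded as bounded by a constant. ''Functions of the quantities ...'' is understood for a fixed activation $\sigma$, fixed relaxation rules for $\sigma'$ and $\sigma''$, and fixed domain $\mathcal{C}$. *)

(* Defs.v *)
From HB Require Import structures.
From mathcomp Require Import all_boot all_order all_algebra.
From mathcomp Require Import all_classical all_reals all_analysis.

Set Implicit Arguments.
Unset Strict Implicit.
Unset Printing Implicit Defensive.

Import Order.TTheory GRing.Theory Num.Theory.
Import numFieldNormedType.Exports.
Local Open Scope classical_set_scope.
Local Open Scope ring_scope.

Notation side := bool (only parsing).
Notation lo := false (only parsing).
Notation up := true (only parsing).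

(** * Networks *)

(* The width d_0 is fixed by the input domain; d_k is [w k] for k >= 1 and
   [w 0] is ignored. *)
Definition width (d0 : nat) (w : nat -> nat) (k : nat) : nat :=
  if k is 0%N then d0 else w k.

(* Layers are numbered from 1; the index 0 of every layer-indexed family is
   meaningless, and no hypothesis is ever made about it. *)
Definition weights (R : realType) (d : nat -> nat) :=
  forall k, 'M[R]_(d k, d k.-1).
Definition biases (R : realType) (d : nat -> nat) := forall k, 'cV[R]_(d k).

Fixpoint postact (R : realType) (sigma : R -> R) (d : nat -> nat)
    (W : weights R d) (b : biases R d) (k : nat) (x : 'cV[R]_(d 0)) :
    'cV[R]_(d k) :=
  match k with
  | 0%N => x
  | k'.+1 => map_mx sigma (W k'.+1 *m postact sigma W b k' x + b k'.+1)
  end.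

Definition preact (R : realType) (sigma : R -> R) (d : nat -> nat)
    (W : weights R d) (b : biases R d) (k : nat) (x : 'cV[R]_(d 0)) :
    'cV[R]_(d k) :=
  W k *m postact sigma W b k.-1 x + b k.

Definition network (R : realType) (sigma : R -> R) (d : nat -> nat)
    (W : weights R d) (b : biases R d) (L : nat) :
    'cV[R]_(d 0) -> 'cV[R]_(d L) :=
  preact sigma W b L.

Definition layer_jacobian (R : realType) (sigma : R -> R) (d : nat -> nat)
    (W : weights R d) (b : biases R d) (k : nat) (x : 'cV[R]_(d 0)) :
    'M[R]_(d k, d k.-1) :=
  diag_mx (map_mx sigma^`()%classic (preact sigma W b k x))^T *m W k.

Definition partial (R : realType) (n : nat) (i : 'I_n) (f : 'cV[R]_n -> R) :
    'cV[R]_n -> R :=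
  fun x => 'D_(delta_mx i 0) f x.

Definition partial2 (R : realType) (n : nat) (i : 'I_n) (f : 'cV[R]_n -> R) :
    'cV[R]_n -> R :=
  partial i (partial i f).

Definition twice_differentiable (R : realType) (f : R -> R) : Prop :=
  (forall t, derivable f t 1) /\ (forall t, derivable f^`()%classic t 1).

(** * Relaxation rules *)

(* A rule maps (l, u) to the coefficients of two affine functions. *)
Record relaxation (R : realType) := Relaxation {
  slope : side -> R -> R -> R;
  icpt : side -> R -> R -> R }.

Definition relaxes (R : realType) (rho : relaxation R) (f : R -> R) : Prop :=
  forall l u t : R, l <= u -> l <= t <= u ->
    slope rho lo l u * t + icpt rho lo l u <= f t /\
    f t <= slope rho up l u * t + icpt rho up l u.

Variant deriv_order := First | Second.

(** * The given bounds *)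

Definition mxle (R : realType) (m n : nat) (A B : 'M[R]_(m, n)) : Prop :=
  forall i j, A i j <= B i j.

(* In both records p stands for d_(k-1) and m for d_k. *)
Record preact_bounds (R : realType) (d0 m : nat) := PreactBounds {
  bound_y : side -> 'cV[R]_m;
  bound_A : side -> 'M[R]_(m, d0);
  bound_a : side -> 'cV[R]_m }.

Record deriv_bounds (R : realType) (d0 p m : nat) := DerivBounds {
  bound_C : side -> 'M[R]_(p, d0);
  bound_c : side -> 'cV[R]_p;
  bound_D : side -> 'I_m -> 'I_p -> 'rV[R]_d0;
  bound_d : side -> 'M[R]_(m, p) }.

Definition affine_C (R : realType) (d0 p m : nat)
    (B : deriv_bounds R d0 p m) (s : side) (x : 'cV[R]_d0) : 'cV[R]_p :=
  bound_C B s *m x + bound_c B s.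

Definition affine_D (R : realType) (d0 p m : nat)
    (B : deriv_bounds R d0 p m) (s : side) (x : 'cV[R]_d0) : 'M[R]_(m, p) :=
  \matrix_(j, n) ((bound_D B s j n *m x) 0 0 + bound_d B s j n).

Definition valid_preact_bounds (R : realType) (d0 m : nat)
    (C : set 'cV[R]_d0) (y : 'cV[R]_d0 -> 'cV[R]_m)
    (B : preact_bounds R d0 m) : Prop :=
  forall x, C x ->
    [/\ mxle (bound_A B lo *m x + bound_a B lo) (y x),
        mxle (y x) (bound_A B up *m x + bound_a B up),
        mxle (bound_y B lo) (y x) &
        mxle (y x) (bound_y B up)].

Definition valid_deriv_bounds (R : realType) (d0 p m : nat)
    (C : set 'cV[R]_d0) (dz : 'cV[R]_d0 -> 'cV[R]_p)
    (J : 'cV[R]_d0 -> 'M[R]_(m, p)) (B : deriv_bounds R d0 p m) : Prop :=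
  forall x, C x ->
    [/\ mxle (affine_C B lo x) (dz x), mxle (dz x) (affine_C B up x),
        mxle (affine_D B lo x) (J x) & mxle (J x) (affine_D B up x)].

(** * Closed-form expressions and their cost *)

(* Real arithmetic, case distinctions on an inequality, and calls to the
   relaxation rules; every node, in particular every call, costs one unit. *)
Inductive expr (R : realType) (V : Type) : Type :=
| Cst of R
| Var of V
| Opp of expr R V
| Add of expr R V & expr R V
| Mul of expr R V & expr R V
| Inv of expr R V
| IfLe of expr R V & expr R V & expr R V & expr R V
| Slope of deriv_order & side & expr R V & expr R V
| Icpt of deriv_order & side & expr R V & expr R V.

Fixpoint eval (R : realType) (rho : deriv_order -> relaxation R) (V : Type)
    (env : V -> R) (e : expr R V) : R :=
  match e with
  | Cst c => c
  | Var v => env v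
  | Opp e1 => - eval rho env e1
  | Add e1 e2 => eval rho env e1 + eval rho env e2
  | Mul e1 e2 => eval rho env e1 * eval rho env e2
  | Inv e1 => (eval rho env e1)^-1
  | IfLe e1 e2 e3 e4 =>
      if eval rho env e1 <= eval rho env e2
      then eval rho env e3 else eval rho env e4
  | Slope o s e1 e2 => slope (rho o) s (eval rho env e1) (eval rho env e2)
  | Icpt o s e1 e2 => icpt (rho o) s (eval rho env e1) (eval rho env e2)
  end.

Fixpoint ecost (R : realType) (V : Type) (e : expr R V) : nat :=
  match e with
  | Cst _ | Var _ => 1
  | Opp e1 | Inv e1 => (ecost e1).+1
  | Add e1 e2 | Mul e1 e2 | Slope _ _ e1 e2 | Icpt _ _ e1 e2 =>
      (ecost e1 + ecost e2).+1
  | IfLe e1 e2 e3 e4 => (ecost e1 + ecost e2 + ecost e3 + ecost e4).+1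
  end.

(** * Recursive schemes over the layers *)

(* The scalar components of psi^(k), for n = d_L outputs and p = d_(k-1),
   together with auxiliary registers. *)
Variant reg (d0 n p : nat) (A : Type) : Type :=
| Psi0 of side & 'I_n & 'I_p
| Psi1 of side & 'I_n & 'I_p & 'I_d0
| Psi2 of side & 'I_n & 'I_p
| Aux of A.
Arguments Psi0 {d0 n p A}.
Arguments Psi1 {d0 n p A}.
Arguments Psi2 {d0 n p A}.
Arguments Aux {d0 n p A}.

Definition reg_code (d0 n p : nat) (A : Type) (r : reg d0 n p A) :
    (side * 'I_n * 'I_p + side * 'I_n * 'I_p * 'I_d0
     + side * 'I_n * 'I_p + A)%type :=
  match r with
  | Psi0 s j l => inl (inl (inl (s, j, l)))
  | Psi1 s j l q => inl (inl (inr (s, j, l, q)))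
  | Psi2 s j l => inl (inr (s, j, l))
  | Aux a => inr a
  end.

Definition reg_decode (d0 n p : nat) (A : Type)
    (c : (side * 'I_n * 'I_p + side * 'I_n * 'I_p * 'I_d0
          + side * 'I_n * 'I_p + A)%type) : reg d0 n p A :=
  match c with
  | inl (inl (inl (s, j, l))) => Psi0 s j l
  | inl (inl (inr (s, j, l, q))) => Psi1 s j l q
  | inl (inr (s, j, l)) => Psi2 s j l
  | inr a => Aux a
  end.

Lemma reg_codeK (d0 n p : nat) (A : Type) :
  cancel (@reg_code d0 n p A) (@reg_decode d0 n p A).
Proof. by case. Qed.

HB.instance Definition _ (d0 n p : nat) (A : finType) :=
  Finite.copy (reg d0 n p A) (can_type (@reg_codeK d0 n p A)).

(* The biases are deliberately not among the inputs below. *)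
Variant preact_input (d0 p m : nat) : Type :=
| In_W of 'I_m & 'I_p
| In_y of side & 'I_m
| In_A of side & 'I_m & 'I_d0
| In_a of side & 'I_m.

Variant deriv_input (d0 p m : nat) : Type :=
| In_C of side & 'I_p & 'I_d0
| In_c of side & 'I_p
| In_D of side & 'I_m & 'I_p & 'I_d0
| In_d of side & 'I_m & 'I_p.

Variant step_input (d0 n p m : nat) (A : Type) : Type :=
| In_preact of preact_input d0 p m
| In_deriv of deriv_input d0 p m
| In_next of reg d0 n m A.

Definition preact_env (R : realType) (d0 p m : nat) (W : 'M[R]_(m, p))
    (B : preact_bounds R d0 m) (v : preact_input d0 p m) : R :=
  match v with
  | In_W j n => W j n
  | In_y s j => bound_y B s j 0
  | In_A s j q => bound_A B s j q
  | In_a s j => bound_a B s j 0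
  end.

Definition deriv_env (R : realType) (d0 p m : nat)
    (B : deriv_bounds R d0 p m) (v : deriv_input d0 p m) : R :=
  match v with
  | In_C s n q => bound_C B s n q
  | In_c s n => bound_c B s n 0
  | In_D s j n q => bound_D B s j n 0 q
  | In_d s j n => bound_d B s j n
  end.

Definition step_env (R : realType) (d0 n p m : nat) (A : Type)
    (W : 'M[R]_(m, p)) (B : preact_bounds R d0 m) (B' : deriv_bounds R d0 p m)
    (next : reg d0 n m A -> R) (v : step_input d0 n p m A) : R :=
  match v with
  | In_preact v => preact_env W B v
  | In_deriv v => deriv_env B' v
  | In_next r => next r
  end.

(* [base n p] yields psi^(L) from the data of layer L, with n = d_L and
   p = d_(L-1); [step n p m] yields psi^(k) from the data of layer k and from
   psi^(k+1), with n = d_L, p = d_(k-1) and m = d_k. The expressions depend on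
   these three widths only, not on the depth or on the rank of the layer. *)
Record scheme (R : realType) (d0 : nat) := Scheme {
  aux : nat -> nat -> finType;
  base : forall n p, reg d0 n p (aux n p) -> expr R (preact_input d0 p n);
  step : forall n p m, reg d0 n p (aux n p) ->
    expr R (step_input d0 n p m (aux n m)) }.

Definition scheme_cost (R : realType) (d0 : nat) (S : scheme R d0)
    (d : nat -> nat) (L : nat) : nat :=
  (\sum_(r : reg d0 (d L) (d L.-1) (aux S (d L) (d L.-1))) ecost (base r)
   + \sum_(1 <= k < L)
       \sum_(r : reg d0 (d L) (d k.-1) (aux S (d L) (d k.-1)))
          ecost (step (d k) r))%N.

Definition psi_family (R : realType) (d0 : nat) (S : scheme R d0)
    (d : nat -> nat) (L : nat) :=
  forall k, reg d0 (d L) (d k.-1) (aux S (d L) (d k.-1)) -> R.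

(* These equations determine psi^(k) for 1 <= k <= L. *)
Definition computed_by (R : realType) (d0 : nat) (S : scheme R d0)
    (rho : deriv_order -> relaxation R) (d : nat -> nat) (L : nat)
    (W : weights R d) (B : forall k, preact_bounds R d0 (d k))
    (B' : forall k, deriv_bounds R d0 (d k.-1) (d k))
    (psi : psi_family S d L) : Prop :=
  (forall r, psi L r = eval rho (preact_env (W L) (B L)) (base r)) /\
  (forall k, (1 <= k < L)%N -> forall r,
     psi k r =
     eval rho (step_env (W k) (B k) (B' k) (psi k.+1)) (step (d k) r)).

(* psi_(0,j,i) + sum_r (psi_(1,j,r) x + psi_(2,j,r)) *)
Definition affine_form (R : realType) (d0 n : nat) (A : Type) (i : 'I_d0)
    (psi : reg d0 n d0 A -> R) (s : side) (j : 'I_n) (x : 'cV[R]_d0) : R :=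
  psi (Psi0 s j i)
  + \sum_(r < d0)
      (((\row_q psi (Psi1 s j r q)) *m x) 0 0 + psi (Psi2 s j r)).

(* Main.v *)
(* Constant enclosures already suffice. Fix x in C, let G^(k)_(j,l) be the derivative of
   output j with respect to z^(k-1)_l, and H^(k)_(j,l,l') its second derivative. The chain
   rule gives G^(k) and H^(k) as polynomials in W^(k), sigma'(y^(k)), sigma''(y^(k)),
   G^(k+1) and H^(k+1), starting from G^(L) = W^(L) and H^(L) = 0. Interval arithmetic
   propagates enclosures of G and H down the layers, sigma' and sigma'' being enclosed by
   the range of their relaxations over [y^(k),L, y^(k),U]. Since z^(0) = x is affine along
   e_i, the second partial derivative of output j is H^(1)_(j,i,i), so psi_0 carries its
   enclosure while psi_1 and psi_2 vanish. *)

Require Import Defs.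
From mathcomp Require Import all_boot all_order all_algebra.
From mathcomp Require Import all_classical all_reals all_analysis.
Import Order.TTheory GRing.Theory Num.Theory.
Import numFieldNormedType.Exports.
Local Open Scope classical_set_scope.
Local Open Scope ring_scope.

Set Implicit Arguments.
Unset Strict Implicit.
Unset Printing Implicit Defensive.

(** * Directional derivatives of the layers *)

Section DirectionalDerivatives.
Variables (R : realType) (V : normedModType R).

(** The two difference quotients agree for every h. Restriction to a line leaves only one-variable
    calculus, so the chain rule below uses nothing beyond derivatives along [v]. *)
Lemma is_derive_lineP (f : V -> R) (x v : V) (df : R) :
  is_derive x v f df <-> is_derive (0 : R) 1 (fun t : R => f (t *: v + x)) df.
Proof.
have E : (fun h : R => h^-1 *: ((f \o shift x) (h *: v) - f x)) =
   (fun h : R => h^-1 *: (((fun t : R => f (t *: v + x)) \o shift 0) (h *: 1)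
     - f (0 *: v + x))).
  by apply/funext => h /=; rewrite addr0 scale0r add0r /GRing.scale /= mulr1.
by split=> -[H1 H2]; apply: DeriveDef; move: H1 H2;
  rewrite /derivable /derive E.
Qed.

Lemma is_derive_comp1 (g : R -> R) (f : V -> R) (x v : V) (dg df : R) :
  is_derive (f x) (1 : R) g dg -> is_derive x v f df ->
  is_derive x v (fun y => g (f y)) (dg * df).
Proof.
move=> Hg /is_derive_lineP Hf; apply/is_derive_lineP.
apply: (@is_derive1_comp _ g (fun t : R => f (t *: v + x))).
by rewrite scale0r add0r.
Qed.

Lemma is_derive_mulmx p m (M : 'M[R]_(m, p)) (f : V -> 'cV[R]_p)
    (df : 'cV[R]_p) (x v : V) (j : 'I_m) :
  (forall n, is_derive x v (fun y => f y n 0) (df n 0)) ->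
  is_derive x v (fun y => (M *m f y) j 0) ((M *m df) j 0).
Proof.
move=> Hf; rewrite mxE.
have -> : (fun y => (M *m f y) j 0) =
    \sum_(n < p) (M j n \*: (fun y => f y n 0)).
  by apply/funext => y; rewrite mxE fct_sumE.
exact: is_derive_sum.
Qed.

End DirectionalDerivatives.

Lemma is_derive_coord (R : realType) n (x v : 'cV[R]_n) (j : 'I_n) :
  is_derive x v (fun y : 'cV[R]_n => y j 0) (v j 0).
Proof.
apply/is_derive_lineP.
have -> : (fun t : R => (t *: v + x) j 0) = (v j 0 \*: id) + cst (x j 0).
  by apply/funext => t; rewrite !mxE mulrC.
by apply: is_derive_eq; rewrite addr0 /GRing.scale /= mulr1.
Qed.

Section Layers.
Variables (R : realType) (sigma : R -> R) (d : nat -> nat).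
Variables (W : weights R d) (b : biases R d) (v : 'cV[R]_(d 0)).

(** Derivative of z^(k) along [v], as an explicit recursion that can be differentiated once more. *)
Fixpoint dpostact (k : nat) (x : 'cV[R]_(d 0)) : 'cV[R]_(d k) :=
  match k with
  | 0%N => v
  | k'.+1 => \col_n (sigma^`()%classic (preact sigma W b k'.+1 x n 0)
                     * (W k'.+1 *m dpostact k' x) n 0)
  end.

Fixpoint ddpostact (k : nat) (x : 'cV[R]_(d 0)) : 'cV[R]_(d k) :=
  match k with
  | 0%N => 0
  | k'.+1 => \col_n (sigma^`(2)%classic (preact sigma W b k'.+1 x n 0)
                       * (W k'.+1 *m dpostact k' x) n 0 ^+ 2
                     + sigma^`()%classic (preact sigma W b k'.+1 x n 0)
                       * (W k'.+1 *m ddpostact k' x) n 0)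
  end.

Hypothesis hsigma : twice_differentiable sigma.

Lemma is_derive_sigma t : is_derive t (1 : R) sigma (sigma^`()%classic t).
Proof. by rewrite derive1E; apply/derivableP; case: hsigma. Qed.

Lemma is_derive_dsigma t :
  is_derive t (1 : R) sigma^`()%classic (sigma^`(2)%classic t).
Proof. by rewrite /derive1n /= derive1E; apply/derivableP; case: hsigma. Qed.

(** Stated relative to the preceding layer, so that it can serve inside the induction over the
    layers. *)
Lemma is_derive_preact_of k x n :
  (forall n, is_derive x v (fun y => postact sigma W b k.-1 y n 0)
               (dpostact k.-1 x n 0)) ->
  is_derive x v (fun y => preact sigma W b k y n 0)
    ((W k *m dpostact k.-1 x) n 0).
Proof.
move=> H.
have -> : (fun y => preact sigma W b k y n 0) =
    (fun y => (W k *m postact sigma W b k.-1 y) n 0) + cst (b k n 0).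
  by apply/funext => y; rewrite /preact mxE.
rewrite -[X in is_derive _ _ _ X]addr0.
by apply: is_deriveD; apply: is_derive_mulmx.
Qed.

Lemma is_derive_postact k x n :
  is_derive x v (fun y => postact sigma W b k y n 0) (dpostact k x n 0).
Proof.
elim: k n => [|k IH] n; first exact: is_derive_coord.
rewrite [dpostact _ _]/= mxE.
have -> : (fun y => postact sigma W b k.+1 y n 0) =
    (fun y => sigma (preact sigma W b k.+1 y n 0)).
  by apply/funext => y; rewrite /= mxE.
apply: is_derive_comp1; first exact: is_derive_sigma.
exact: is_derive_preact_of.
Qed.

Lemma is_derive_preact k x n :
  is_derive x v (fun y => preact sigma W b k y n 0)
    ((W k *m dpostact k.-1 x) n 0).
Proof. by apply: is_derive_preact_of => ?; apply: is_derive_postact. Qed.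

Lemma is_derive_dpostact k x n :
  is_derive x v (fun y => dpostact k y n 0) (ddpostact k x n 0).
Proof.
elim: k n => [|k IH] n /=.
  by rewrite mxE; apply: (is_derive_cst (v n 0)).
rewrite mxE.
have -> : (fun y => (\col_n0 (sigma^`()%classic (preact sigma W b k.+1 y n0 0)
                     * (W k.+1 *m dpostact k y) n0 0)) n 0) =
  (fun y => sigma^`()%classic (preact sigma W b k.+1 y n 0))
   * (fun y => (W k.+1 *m dpostact k y) n 0).
  by apply/funext => y; rewrite mxE.
apply: is_derive_eq.
  apply: is_deriveM; last exact: is_derive_mulmx.
  by apply: is_derive_comp1; [exact: is_derive_dsigma|exact: is_derive_preact].
by rewrite /GRing.scale /= addrC expr2; congr (_ + _); exact: mulrCA.
Qed.

End Layers.

Lemma partial2_network (R : realType) (sigma : R -> R) (d : nat -> nat)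
    (W : weights R d) (b : biases R d) (L : nat) (i : 'I_(d 0)) (j : 'I_(d L))
    (x : 'cV[R]_(d 0)) :
  twice_differentiable sigma ->
  partial2 i (fun x' => network sigma W b L x' j 0) x =
  (W L *m ddpostact sigma W b (delta_mx i 0) L.-1 x) j 0.
Proof.
move=> hs; rewrite /partial2 /partial /network.
(* The inner derivative is identified at every point, since it is differentiated again. *)
have -> : (fun y => 'D_(delta_mx i 0) (fun x' => preact sigma W b L x' j 0) y) =
    (fun y => (W L *m dpostact sigma W b (delta_mx i 0) L.-1 y) j 0).
  apply/funext => y.
  by have := is_derive_preact W b (delta_mx i 0) hs y j => H; rewrite derive_val.
by have H := is_derive_mulmx (W L) j (is_derive_dpostact W b (delta_mx i 0) hs (k := L.-1) x);
  rewrite derive_val.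
Qed.

(** * Interval arithmetic on expressions *)

Section Intervals.
Variables (R : realType) (V : Type).

Definition ival := side -> expr R V.

Definition emin (a b : expr R V) := IfLe a b a b.
Definition emax (a b : expr R V) := IfLe a b b a.

Definition ipoint (e : expr R V) : ival := fun _ => e.

Definition iadd (X Y : ival) : ival := fun s => Add (X s) (Y s).

(** A product over a rectangle attains its extrema at the four corners. *)
Definition imul (X Y : ival) : ival := fun s =>
  let opt := if s then emax else emin in
  opt (opt (Mul (X lo) (Y lo)) (Mul (X lo) (Y up)))
      (opt (Mul (X up) (Y lo)) (Mul (X up) (Y up))).

(** For each side, the affine relaxation on that side is evaluated over the interval and only its
    end on that side is kept. *)
Definition irelax (o : deriv_order) (X : ival) : ival := fun s =>
  iadd (imul (ipoint (Slope o s (X lo) (X up))) X)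
       (ipoint (Icpt o s (X lo) (X up))) s.

Variables (rho : deriv_order -> relaxation R) (env : V -> R).

Definition encloses (X : ival) (t : R) : Prop :=
  Defs.eval rho env (X lo) <= t <= Defs.eval rho env (X up).

Lemma eval_emin a b :
  Defs.eval rho env (emin a b) = Num.min (Defs.eval rho env a) (Defs.eval rho env b).
Proof. by rewrite /= minEle. Qed.

Lemma eval_emax a b :
  Defs.eval rho env (emax a b) = Num.max (Defs.eval rho env a) (Defs.eval rho env b).
Proof. by rewrite /= maxEle. Qed.

Lemma encloses_point e : encloses (ipoint e) (Defs.eval rho env e).
Proof. by rewrite /encloses /= lexx. Qed.

Lemma encloses_add X Y s t :
  encloses X s -> encloses Y t -> encloses (iadd X Y) (s + t).
Proof.
by move=> /andP[a1 a2] /andP[b1 b2]; apply/andP; split; apply: lerD.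
Qed.

Lemma minmax_mulr (a l u t : R) : l <= t <= u ->
  Num.min (a * l) (a * u) <= a * t <= Num.max (a * l) (a * u).
Proof.
move=> /andP[lt tu]; rewrite ge_min le_max.
have [a0|/ltW a0] := leP 0 a.
  by rewrite (ler_wpM2l a0 lt) (ler_wpM2l a0 tu) orbT.
by rewrite (ler_wnM2l a0 lt) (ler_wnM2l a0 tu) orbT.
Qed.

Lemma encloses_mul X Y s t :
  encloses X s -> encloses Y t -> encloses (imul X Y) (s * t).
Proof.
move=> Xs Yt; rewrite /encloses /imul !eval_emin !eval_emax [Defs.eval _ _ (Mul _ _)]/=.
(* Bilinearity: with [t] fixed the product lies between its values at the ends of [X], and each of
   these lies between its values at the ends of [Y]. *)
have /andP[st1 st2] := minmax_mulr t Xs; rewrite !(mulrC t) in st1 st2.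
have /andP[l1 l2] := minmax_mulr (Defs.eval rho env (X lo)) Yt.
have /andP[u1 u2] := minmax_mulr (Defs.eval rho env (X up)) Yt.
apply/andP; split.
  by apply: le_trans st1; exact: le_min2.
by apply: le_trans st2 _; exact: le_max2.
Qed.

Lemma encloses_relax o X f t : relaxes (rho o) f ->
  encloses X t -> encloses (irelax o X) (f t).
Proof.
move=> hf Xt; have /andP[Xl Xu] := Xt.
have [fl fu] := hf _ _ t (le_trans Xl Xu) Xt.
have P s := encloses_add
  (encloses_mul (encloses_point (Slope o s (X lo) (X up))) Xt)
  (encloses_point (Icpt o s (X lo) (X up))).
have /andP[Pl _] := P lo; have /andP[_ Pu] := P up.
by apply/andP; split; [apply: le_trans Pl fl|apply: le_trans fu Pu].
Qed.

(** Compatibility with 0 and [iadd] suffices; on expressions, [iadd] obeys no monoid law. *)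
Lemma encloses_sum (I : finType) (X : I -> ival) (t : I -> R) :
  (forall i, encloses (X i) (t i)) ->
  encloses (\big[iadd/ipoint (Cst V 0)]_i X i) (\sum_i t i).
Proof.
move=> Xt; apply: (big_ind2 encloses) => [|*|//]; last exact: encloses_add.
exact: (encloses_point (Cst V 0)).
Qed.

End Intervals.

(** * The scheme *)

Section Scheme.
Variables (R : realType) (d0 : nat).

(* [inl (s, j, l)] bounds the derivative of output j in z^(k-1)_l, and
   [inr (s, j, l, l')] its second derivative in z^(k-1)_l and z^(k-1)_l'. *)
Definition curv_aux (n p : nat) : finType :=
  (side * 'I_n * 'I_p + side * 'I_n * 'I_p * 'I_p)%type.

(** The recursion reads only the [Aux] registers. [Psi0] copies the diagonal of the Hessian
    enclosure, whose entry (i, i) is read off at layer 1. *)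
Definition reg_of_bounds (V : Type) (n p : nat) (G : 'I_n -> 'I_p -> ival R V)
    (H : 'I_n -> 'I_p -> 'I_p -> ival R V) (r : reg d0 n p (curv_aux n p)) :
    expr R V :=
  match r with
  | Psi0 s j l => H j l l s
  | Psi1 _ _ _ _ | Psi2 _ _ _ => Cst V 0
  | Aux (inl (s, j, l)) => G j l s
  | Aux (inr (s, j, l, l')) => H j l l' s
  end.

Definition base_grad (n p : nat) (j : 'I_n) (l : 'I_p) :
    ival R (preact_input d0 p n) :=
  ipoint (Var R (In_W d0 j l)).

Section Step.
Variables n p m : nat.

Definition step_var := step_input d0 n p m (curv_aux n m).

Definition next_grad (j : 'I_n) (q : 'I_m) : ival R step_var :=
  fun s => Var R (In_next p (Aux (inl (s, j, q)))).

Definition next_hess (j : 'I_n) (q q' : 'I_m) : ival R step_var :=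
  fun s => Var R (In_next p (Aux (inr (s, j, q, q')))).

Definition step_weight (q : 'I_m) (l : 'I_p) : ival R step_var :=
  ipoint (Var R (In_preact n _ (In_W d0 q l))).

Definition step_sigma (o : deriv_order) (q : 'I_m) : ival R step_var :=
  irelax o (fun s => Var R (In_preact n _ (In_y d0 p s q))).

Definition step_jac (q : 'I_m) (l : 'I_p) : ival R step_var :=
  imul (step_sigma First q) (step_weight q l).

Definition step_grad (j : 'I_n) (l : 'I_p) : ival R step_var :=
  \big[@iadd R step_var/ipoint (Cst _ 0)]_q
    imul (next_grad j q) (step_jac q l).

(** Second-order chain rule: the curvature of layer k weighted by the gradient of the layers above
    it, plus their Hessian transported by the layer Jacobian. *)
Definition step_hess (j : 'I_n) (l l' : 'I_p) : ival R step_var :=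
  iadd
    (\big[@iadd R step_var/ipoint (Cst _ 0)]_q
       imul (next_grad j q)
         (imul (step_sigma Second q)
            (imul (step_weight q l) (step_weight q l'))))
    (\big[@iadd R step_var/ipoint (Cst _ 0)]_q
       \big[@iadd R step_var/ipoint (Cst _ 0)]_q'
         imul (next_hess j q q') (imul (step_jac q l) (step_jac q' l'))).

End Step.

Definition curvature_scheme : scheme R d0 :=
  @Scheme R d0 curv_aux
    (fun n p => reg_of_bounds (@base_grad n p)
                  (fun _ _ _ => ipoint (Cst _ 0)))
    (fun n p m => reg_of_bounds (@step_grad n p m) (@step_hess n p m)).

End Scheme.

(* The cost of a layer depends on its widths only, so that any scheme is linear in the
   depth once the widths are bounded. *)
Lemma scheme_cost_linear (R : realType) (d0 : nat) (S : scheme R d0) (D : nat) :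
  exists K : nat, forall (L : nat) (d : nat -> nat),
    (0 < L)%N -> (forall k, (k <= L)%N -> (d k <= D)%N) ->
    (scheme_cost S d L <= K * L)%N.
Proof.
pose cbase n p := (\sum_(r : reg d0 n p (aux S n p)) ecost (base r))%N.
pose cstep n p m :=
  (\sum_(r : reg d0 n p (aux S n p)) ecost (step (s := S) m r))%N.
(* Summing over all widths up to [D] dominates the cost of any single layer. *)
pose K := (\sum_(n < D.+1) \sum_(p < D.+1)
  (cbase n p + \sum_(m < D.+1) cstep n p m))%N.
have term_le (F : 'I_D.+1 -> nat) i : (F i <= \sum_(i0 < D.+1) F i0)%N.
  by rewrite (bigD1 i) //= leq_addr.
have Kle n p : (n <= D)%N -> (p <= D)%N ->
    (cbase n p + \sum_(m < D.+1) cstep n p m <= K)%N.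
  rewrite -[(n <= D)%N]ltnS -[(p <= D)%N]ltnS => hn hp.
  apply: leq_trans (term_le _ (Ordinal hn)).
  exact: leq_trans (term_le _ (Ordinal hp)).
exists K => L d L0 hd; rewrite /scheme_cost -/(cbase _ _).
(* One [K] pays for the last layer, and L - 1 copies pay for the others. *)
rewrite -[in X in (_ <= X)%N](prednK L0) mulnS; apply: leq_add.
  apply: leq_trans (Kle _ _ (hd _ (leqnn _)) (hd _ (leq_pred _))).
  exact: leq_addr.
rewrite mulnC -subn1 -sum_nat_const_nat big_nat [in X in (_ <= X)%N]big_nat.
apply: leq_sum => k /andP[k1 kL].
have hk : (d k < D.+1)%N by rewrite ltnS hd // ltnW.
apply: leq_trans (Kle (d L) (d k.-1) (hd _ (leqnn _)) _); last first.
  by rewrite hd // (leq_trans (leq_pred _)) // ltnW.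
exact: leq_trans (term_le (cstep _ _) (Ordinal hk)) (leq_addl _ _).
Qed.

(** The register type varies with k, so the family is built by dependent updates, one layer at a
    time from L downwards; f counts the layers below L already treated. *)
Lemma computed_by_exists (R : realType) (d0 : nat) (S : scheme R d0)
    (rho : deriv_order -> relaxation R) (d : nat -> nat) (L : nat)
    (W : weights R d) (B : forall k, preact_bounds R d0 (d k))
    (B' : forall k, deriv_bounds R d0 (d k.-1) (d k)) :
  exists psi : psi_family S d L, computed_by rho W B B' psi.
Proof.
pose T k := reg d0 (d L) (d k.-1) (aux S (d L) (d k.-1)) -> R.
suff /(_ L) [psi [h1 h2]] : forall f, exists psi : psi_family S d L,
    (forall r, psi L r = Defs.eval rho (preact_env (W L) (B L)) (base r)) /\
    (forall k, (1 <= k < L)%N -> (L - f <= k)%N -> forall r, psi k r =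
     Defs.eval rho (step_env (W k) (B k) (B' k) (psi k.+1)) (step (s := S) (d k) r)).
  by exists psi; split=> // k hk; apply: h2; rewrite // subnn.
elim=> [|f [psi [h1 h2]]].
  (* The value 0 is a placeholder: for f = 0 no layer below L is constrained. *)
  exists (@eqtype.dfwith nat T (fun _ _ => 0) L
    (fun r => Defs.eval rho (preact_env (W L) (B L)) (base (s := S) r))).
  split=> [r|k /andP[_ kL]]; first by rewrite eqtype.dfwith_in.
  by rewrite subn0 leqNgt kL.
case: (leqP L f) => [Lf|fL].
  exists psi; split=> // k hk _; apply: h2 => //.
  by move: Lf; rewrite -subn_eq0 => /eqP->.
pose k0 := (L - f.+1)%N.
have k0S : (L - f)%N = k0.+1 by rewrite /k0 subnS prednK // subn_gt0.
have k0L : (k0 < L)%N by rewrite -k0S leq_subr.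
(* Overwriting index [k0] preserves the equations above it, which read only larger indices. *)
exists (@eqtype.dfwith nat T psi k0 (fun r =>
  Defs.eval rho (step_env (W k0) (B k0) (B' k0) (psi k0.+1)) (step (s := S) (d k0) r))).
split=> [r|k hk]; first by rewrite eqtype.dfwith_out ?h1 // ltn_eqF.
rewrite -/k0 leq_eqVlt => /orP[/eqP <-|k0k] r.
  by rewrite eqtype.dfwith_in eqtype.dfwith_out // ltn_eqF.
by rewrite !eqtype.dfwith_out ?ltn_eqF ?h2 // ?k0S // ltnW.
Qed.

(** * Soundness of one layer of interval propagation *)

Section Soundness.
Variables (R : realType) (sigma : R -> R) (rho : deriv_order -> relaxation R).
Hypothesis hrho1 : relaxes (rho First) sigma^`()%classic.
Hypothesis hrho2 : relaxes (rho Second) sigma^`(2)%classic.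
Variables (d0 n p m : nat) (W : 'M[R]_(m, p)) (B : preact_bounds R d0 m).
Variables (B' : deriv_bounds R d0 p m) (next : reg d0 n m (curv_aux n m) -> R).
Variables (y : 'cV[R]_m) (G : 'I_n -> 'I_m -> R) (H : 'I_n -> 'I_m -> 'I_m -> R).
Hypothesis hy : mxle (bound_y B lo) y /\ mxle y (bound_y B up).
Hypothesis hG : forall j q,
  next (Aux (inl (lo, j, q))) <= G j q <= next (Aux (inl (up, j, q))).
Hypothesis hH : forall j q q',
  next (Aux (inr (lo, j, q, q'))) <= H j q q' <= next (Aux (inr (up, j, q, q'))).

Let env := step_env W B B' next.

Lemma encloses_step_sigma o f q : relaxes (rho o) f ->
  encloses rho env (step_sigma R d0 n p o q) (f (y q 0)).
Proof.
move=> hf; apply: encloses_relax => //.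
by case: hy => yl yu; rewrite /encloses /= yl yu.
Qed.

Lemma encloses_step_weight q l : encloses rho env (step_weight R d0 n q l) (W q l).
Proof. by rewrite /encloses /= lexx. Qed.

Lemma encloses_step_jac q l : encloses rho env (step_jac R d0 n q l)
  (sigma^`()%classic (y q 0) * W q l).
Proof.
by apply: encloses_mul; [exact: encloses_step_sigma|exact: encloses_step_weight].
Qed.

Lemma encloses_step_grad j l : encloses rho env (step_grad R d0 m j l)
  (\sum_q G j q * (sigma^`()%classic (y q 0) * W q l)).
Proof.
apply: encloses_sum => q; apply: encloses_mul; first exact: hG.
exact: encloses_step_jac.
Qed.

Lemma encloses_step_hess j l l' : encloses rho env (step_hess R d0 m j l l')
  (\sum_q G j q * (sigma^`(2)%classic (y q 0) * (W q l * W q l'))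
   + \sum_q \sum_q' H j q q' * (sigma^`()%classic (y q 0) * W q l
                                * (sigma^`()%classic (y q' 0) * W q' l'))).
Proof.
apply: encloses_add; apply: encloses_sum => q.
  apply: encloses_mul; first exact: hG.
  apply: encloses_mul; first exact: encloses_step_sigma.
  by apply: encloses_mul; exact: encloses_step_weight.
apply: encloses_sum => q'; apply: encloses_mul; first exact: hH.
by apply: encloses_mul; exact: encloses_step_jac.
Qed.

End Soundness.

(** * The second-order chain rule as an algebraic identity *)

Lemma sum2_mull (R : comRingType) (I J : finType) (x : J -> I -> I -> R)
    (c : I -> I -> R) :
  \sum_l \sum_l' (\sum_q x q l l') * c l l' =
  \sum_q \sum_l \sum_l' x q l l' * c l l'.
Proof.
rewrite [RHS]exchange_big /=; apply: eq_bigr => l _.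
by rewrite [RHS]exchange_big /=; apply: eq_bigr => l' _; rewrite mulr_suml.
Qed.

(* If the second derivative of an output along a line is the contraction of G with the
   second derivative of z^(k) plus that of H with the square of its first derivative,
   then the chain rule yields the same in terms of z^(k-1). *)
Lemma curvature_pullback (R : comRingType) (p m : nat) (W : 'M[R]_(m, p))
    (s1 s2 G : 'I_m -> R) (H : 'I_m -> 'I_m -> R) (e g : 'cV[R]_p) :
  \sum_q G q * (s2 q * (W *m e) q 0 ^+ 2 + s1 q * (W *m g) q 0)
  + \sum_q \sum_q' H q q' * (s1 q * (W *m e) q 0 * (s1 q' * (W *m e) q' 0)) =
  \sum_l (\sum_q G q * (s1 q * W q l)) * g l 0
  + \sum_l \sum_l'
      (\sum_q G q * (s2 q * (W q l * W q l'))
       + \sum_q \sum_q' H q q' * (s1 q * W q l * (s1 q' * W q' l')))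
      * (e l 0 * e l' 0).
Proof.
have quad (a b : 'I_p -> R) :
    (\sum_l a l * e l 0) * (\sum_l b l * e l 0) =
    \sum_l \sum_l' a l * b l' * (e l 0 * e l' 0).
  rewrite big_distrlr; apply: eq_bigr => l _; apply: eq_bigr => l' _.
  exact: mulrACA.
have jac q : s1 q * (W *m e) q 0 = \sum_l s1 q * W q l * e l 0.
  by rewrite mxE mulr_sumr; apply: eq_bigr => l _; rewrite mulrA.
have split2 (X Y c : 'I_p -> 'I_p -> R) :
    \sum_l \sum_l' (X l l' + Y l l') * c l l' =
    \sum_l \sum_l' X l l' * c l l' + \sum_l \sum_l' Y l l' * c l l'.
  rewrite -big_split; apply: eq_bigr => l _.
  by rewrite -big_split; apply: eq_bigr => l' _; exact: mulrDl.
rewrite split2 !sum2_mull addrA.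
(* The terms in [H] are matched first; the terms in [G] then split into a part linear in [g] and a
   part quadratic in [e]. *)
congr (_ + _); last first.
  apply: eq_bigr => q _; rewrite sum2_mull; apply: eq_bigr => q' _.
  rewrite !jac quad mulr_sumr; apply: eq_bigr => l _.
  by rewrite mulr_sumr; apply: eq_bigr => l' _; rewrite !mulrA.
under eq_bigr do rewrite mulrDr; rewrite big_split /= addrC; congr (_ + _).
  under [in RHS]eq_bigr do rewrite mulr_suml.
  rewrite [RHS]exchange_big /=; apply: eq_bigr => q _.
  by rewrite mxE !mulr_sumr; apply: eq_bigr => l _; rewrite !mulrA.
apply: eq_bigr => q _; rewrite mxE expr2 quad !mulr_sumr.
apply: eq_bigr => l _; rewrite !mulr_sumr; apply: eq_bigr => l' _.
by rewrite !mulrA.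
Qed.

(** * Descent of the enclosures from the last layer *)

Section Enclosure.
Variables (R : realType) (sigma : R -> R) (rho : deriv_order -> relaxation R).
Hypothesis hrho1 : relaxes (rho First) sigma^`()%classic.
Hypothesis hrho2 : relaxes (rho Second) sigma^`(2)%classic.
Variables (d : nat -> nat) (L : nat) (W : weights R d) (b : biases R d).
Variables (B : forall k, preact_bounds R (d 0) (d k)).
Variables (B' : forall k, deriv_bounds R (d 0) (d k.-1) (d k)).
Variable psi : psi_family (curvature_scheme R (d 0)) d L.
Hypothesis hpsi : computed_by rho W B B' psi.
Variables (v x : 'cV[R]_(d 0)).
Hypothesis hy : forall k, (1 <= k < L)%N ->
  mxle (bound_y (B k) lo) (preact sigma W b k x) /\
  mxle (preact sigma W b k x) (bound_y (B k) up).

Let dz k := dpostact sigma W b v k x.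
Let ddz k := ddpostact sigma W b v k x.

(** Induction on L - k. The left side of the identity does not depend on k, and only its
    representation by [G] and [H] changes, so no mixed partial derivative is ever taken. *)
Lemma psi_encloses_curvature k : (1 <= k <= L)%N ->
  exists (G : 'I_(d L) -> 'I_(d k.-1) -> R)
         (H : 'I_(d L) -> 'I_(d k.-1) -> 'I_(d k.-1) -> R),
    [/\ forall j l, psi (Aux (inl (lo, j, l))) <= G j l
                    <= psi (Aux (inl (up, j, l))),
        forall j l l', psi (Aux (inr (lo, j, l, l'))) <= H j l l'
                    <= psi (Aux (inr (up, j, l, l'))) &
        forall j, (W L *m ddz L.-1) j 0 =
          \sum_l G j l * ddz k.-1 l 0
          + \sum_l \sum_l' H j l l' * (dz k.-1 l 0 * dz k.-1 l' 0)].
Proof.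
move=> /andP[k1 kL].
have [f kf] : exists f, (k + f)%N = L by exists (L - k)%N; rewrite subnKC.
case: hpsi => hbase hstep {kL}.
elim: f => [|f IH] in k k1 kf *.
  rewrite addn0 in kf; subst k.
  exists (fun j l => W L j l), (fun _ _ _ => 0); split.
  - by move=> j l; rewrite !hbase /= lexx.
  - by move=> j l l'; rewrite !hbase /= lexx.
  - move=> j; rewrite mxE [X in _ + X]big1 ?addr0 // => l _.
    by rewrite big1 // => l' _; rewrite mul0r.
have kL : (1 <= k < L)%N by rewrite k1 -kf -addSnnS leq_addr.
case: (IH k.+1 isT); first by rewrite addSnnS.
move=> G [H [hG hH E]].
have yk := hy kL.
pose s1 q := sigma^`()%classic (preact sigma W b k x q 0).
pose s2 q := sigma^`(2)%classic (preact sigma W b k x q 0).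
exists (fun j l => \sum_q G j q * (s1 q * W k q l)).
exists (fun j l l' => \sum_q G j q * (s2 q * (W k q l * W k q l'))
   + \sum_q \sum_q' H j q q' * (s1 q * W k q l * (s1 q' * W k q' l'))).
split.
- move=> j l; rewrite !hstep //.
  exact: (encloses_step_grad hrho1 (W k) (B' k) yk hG).
- move=> j l l'; rewrite !hstep //.
  exact: (encloses_step_hess hrho1 hrho2 (W k) (B' k) yk hG hH).
- move=> j; rewrite E -curvature_pullback [k.+1.-1]/=.
  have [dzE ddzE] : (forall q, dz k q 0 = s1 q * (W k *m dz k.-1) q 0) /\
      (forall q, ddz k q 0 = s2 q * (W k *m dz k.-1) q 0 ^+ 2
                             + s1 q * (W k *m ddz k.-1) q 0).
    (* The recursions unfold only at a successor; hypotheses depending on [k] are dropped to allow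
       the case analysis. *)
    rewrite /dz /ddz /s1 /s2; clear -k1.
    by case: k k1 => // k _; split=> q; rewrite [LHS]mxE.
  congr (_ + _); apply: eq_bigr => q _; first by rewrite ddzE.
  by apply: eq_bigr => q' _; rewrite !dzE.
Qed.

End Enclosure.

(** * Evaluation at the input layer in the direction e_i *)

Theorem theorem2 (R : realType) (sigma : R -> R)
    (rho : deriv_order -> relaxation R)
    (d0 : nat) (C : set 'cV[R]_d0) (i : 'I_d0)
    (hsigma : twice_differentiable sigma)
    (hrho1 : relaxes (rho First) sigma^`()%classic)
    (hrho2 : relaxes (rho Second) sigma^`(2)%classic) :
  exists S : scheme R d0,
    (forall D : nat, exists K : nat, forall (L : nat) (w : nat -> nat),
       (0 < L)%N -> (forall k, (k <= L)%N -> (width d0 w k <= D)%N) ->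
       (scheme_cost S (width d0 w) L <= K * L)%N) /\
    (forall (L : nat) (w : nat -> nat) (d := width d0 w)
        (W : weights R d) (b : biases R d)
        (B : forall k, preact_bounds R d0 (d k))
        (B' : forall k, deriv_bounds R d0 (d k.-1) (d k)),
       (0 < L)%N ->
       (forall k, (1 <= k <= L)%N ->
          valid_preact_bounds C (preact sigma W b k) (B k)) ->
       (forall k, (1 <= k <= L.-1)%N ->
          valid_deriv_bounds C
            (fun x => \col_n partial i (fun x' => postact sigma W b k.-1 x' n 0) x)
            (layer_jacobian sigma W b k) (B' k)) ->
       exists psi : psi_family S d L,
         computed_by rho W B B' psi /\
         forall j : 'I_(d L), exists uL uU : 'cV[R]_d0 -> R,
           [/\ forall x, C x ->
                 uL x <= partial2 i (fun x' => network sigma W b L x' j 0) x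
                      <= uU x,
               forall x, uU x = affine_form i (psi 1%N) up j x &
               forall x, uL x = affine_form i (psi 1%N) lo j x]).
Proof.
exists (curvature_scheme R d0); split.
  move=> D; have [K hK] := scheme_cost_linear (curvature_scheme R d0) D.
  by exists K => L w; apply: hK.
move=> L w d W b B B' L0 hB _.
have [psi hpsi] :=
  computed_by_exists (curvature_scheme R d0) rho L W B B'.
exists psi; split => // j.
exists (affine_form i (psi 1%N) lo j), (affine_form i (psi 1%N) up j).
split => // x Cx.
have hy k : (1 <= k < L)%N -> mxle (bound_y (B k) lo) (preact sigma W b k x) /\
    mxle (preact sigma W b k x) (bound_y (B k) up).
  by move=> /andP[k1 kL]; case: (hB k _ x Cx) => //; rewrite k1 ltnW.
have [|G [H [_ hH E]]] := psi_encloses_curvature (d := d) hrho1 hrho2 hpsi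
  (delta_mx i 0) hy (k := 1); first by rewrite L0.
have psi_const s : affine_form i (psi 1%N) s j x = psi 1%N (Aux (inr (s, j, i, i))).
  have [psi0 psi1 psi2] : [/\ psi 1%N (Psi0 s j i) = psi 1%N (Aux (inr (s, j, i, i))),
      forall r q, psi 1%N (Psi1 s j r q) = 0 & forall r, psi 1%N (Psi2 s j r) = 0].
    case: (hpsi) => hbase hstep.
    (* Layer 1 is produced by [step] when L > 1 and by [base] when L = 1. *)
    have [L1|L1] := ltnP 1 L; first by split=> *; rewrite !(hstep 1%N).
    have LE : L = 1%N by apply/eqP; rewrite eqn_leq L1.
    by subst L; split=> *; rewrite !hbase.
  rewrite /affine_form psi0 big1 ?addr0 // => r _.
  by rewrite psi2 addr0 mxE big1 // => q _; rewrite mxE psi1 mul0r.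
rewrite !psi_const (partial2_network (d := d)) // E.
(* At the input the first derivative is e_i and the second is 0, so only the entry (i, i) of [H]
   survives. *)
suff -> : \sum_l G j l * ddpostact sigma W b (delta_mx i 0) 0 x l 0
    + \sum_l \sum_l' H j l l' * (dpostact sigma W b (delta_mx i 0) 0 x l 0
        * dpostact sigma W b (delta_mx i 0) 0 x l' 0) = H j i i by apply: hH.
rewrite [X in X + _]big1 => [|l _]; last by rewrite mxE mulr0.
rewrite add0r /= (bigD1 i) //= (bigD1 i) //= !mxE !eqxx !mulr1.
rewrite !big1 ?addr0 // => [l li|l' li].
  by rewrite big1 // => l' _; rewrite !mxE (negPf li) mul0r mulr0.
by rewrite !mxE (negPf li) !mulr0.
Qed.
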